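(* Let $Y$ be a real valued random variable and $\mathbf{X}=(X_i)_{i\in\mathbb{N}}$ a sequence of real valued random variables, and let $Z$ be a random variable with values in a Borel space $(E,\mathcal{E})$. Assume: (A1) For each $i\in\mathbb{N}$ a Markov kernel $(P^i_{x,\mathbf{x}})_{(x,\mathbf{x})\in\mathbb{R}\times\mathbb{R}^{\mathbb{N}}}$ on $\mathbb{R}$ is fixed, which is a regular conditional distribution of $Y$ given $(X_i,\mathbf{X}_{-i})=(x,\mathbf{x})$, and $\iint |y|\,P^i_{x,\mathbf{x}}(\mathrm{d}y)\,P^{-i}(\mathrm{d}\mathbf{x})<\infty$ for all $x\in\mathbb{R}$, where $P^{-i}$ is the distribution of $\mathbf{X}_{-i}$. (A2) $X_1,X_2,\ldots$ are conditionally independent given $Z$, and $\sigma(Z)\subseteq\bigcap_{i=1}^\infty\sigma(\mathbf{X}_{-i})$. Fix $i\in\mathbb{N}$ and let $P^{-i}_z$ denote a regular conditional distribution of $\mathbf{X}_{-i}$ given $Z=z$. Then the Markov kernel $$Q^i_{x,z}(A)=\int P^i_{x,\mathbf{x}}(A)\,P^{-i}_z(\mathrm{d}\mathbf{x}),\qquad A\subseteq\mathbb{R}\text{ measurable},$$ is a regular conditional distribution of $Y$ given $(X_i,Z)=(x,z)$, and, with $P^Z$ the distribution of $Z$, $$\chi^i_x=\iint y\,Q^i_{x,z}(\mathrm{d}y)\,P^Z(\mathrm{d}z)=\mathbb{E}\big[\mathbb{E}[Y\mid X_i=x;Z]\big]$$ for every $x \in \mathbb{R}$.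
   Context: $\mathbf{X}_{-i}=(X_j)_{j\in\mathbb{N}\setminus\{i\}}$, regarded as taking values in $\mathbb{R}^{\mathbb{N}}$ (identified with $\mathbb{R}^{\mathbb{N}\setminus\{i\}}$). $\mathbb{R}$ carries the Borel $\sigma$-algebra and $\mathbb{R}^{\mathbb{N}}$ the product $\sigma$-algebra. The adjusted mean is defined as $$\chi^i_x=\iint y\,P^i_{x,\mathbf{x}}(\mathrm{d}y)\,P^{-i}(\mathrm{d}\mathbf{x}),$$ where $(P^i_{x,\mathbf{x}})$ is the fixed kernel and $P^{-i}$ the distribution of $\mathbf{X}_{-i}$. The expression $\mathbb{E}[\mathbb{E}[Y\mid X_i=x;Z]]$ is notation for $\iint y\,Q^i_{x,z}(\mathrm{d}y)\,P^Z(\mathrm{d}z)$, i.e. the inner conditional expectation is the version $\mathbb{E}[Y\mid X_i=x;Z=z]=\int y\,Q^i_{x,z}(\mathrm{d}y)$. *)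

(* Defs.v *)
From HB Require Import structures.
From mathcomp Require Import all_boot all_order all_algebra.
From mathcomp Require Import finmap.
From mathcomp Require Import all_classical all_reals all_analysis.
From mathcomp Require Import measurable_function measurable_realfun.

Set Implicit Arguments.
Unset Strict Implicit.
Unset Printing Implicit Defensive.

Import Order.TTheory GRing.Theory Num.Theory.
Import numFieldNormedType.Exports.

Local Open Scope classical_set_scope.
Local Open Scope ring_scope.

(* The countable power T^N, as an alias of nat -> T carrying the product
   sigma-algebra. *)
Definition seqspace (T : Type) : Type := nat -> T.

Definition seqspace_display : measure_display -> measure_display.
Proof. exact. Qed.

Section seqspace_measurable.
Context d (T : measurableType d).

HB.instance Definition _ := Pointed.copy (seqspace T) (nat -> T).

Definition seqspace_measurable : set (set (seqspace T)) :=
  <<s \bigcup_j preimage_set_system setT (fun x : seqspace T => x j)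
                  measurable >>.

Let seqspace0 : seqspace_measurable set0.
Proof. exact: sigma_algebra0. Qed.

Let seqspaceC A : seqspace_measurable A -> seqspace_measurable (~` A).
Proof. exact: sigma_algebraC. Qed.

Let seqspace_bigcup (F : (set (seqspace T))^nat) :
  (forall i, seqspace_measurable (F i)) ->
  seqspace_measurable (\bigcup_i (F i)).
Proof. exact: sigma_algebra_bigcup. Qed.

HB.instance Definition _ := @isMeasurable.Build (seqspace_display d)
  (seqspace T) seqspace_measurable seqspace0 seqspaceC seqspace_bigcup.

Lemma measurable_seqspace_coord (j : nat) :
  measurable_fun setT (fun x : seqspace T => x j).
Proof.
by move=> _ B mB; apply: sub_sigma_algebra; exists j => //; exists B.
Qed.

Lemma measurable_fun_seqspace d' (S : measurableType d') (f : S -> seqspace T) :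
  (forall j, measurable_fun setT (fun s => f s j)) -> measurable_fun setT f.
Proof.
move=> mf; apply: (@measurability _ _ _ _ setT f
  (\bigcup_j preimage_set_system setT (fun x : seqspace T => x j) measurable))
  => //.
move=> _ [_ [j _ [B mB <-]] <-].
by rewrite !setTI; have := mf j measurableT B mB; rewrite setTI.
Qed.

End seqspace_measurable.

(* Isomorphic, as a measurable space, to a Borel subset B of the real line;
   f and g are the two directions of the isomorphism. *)
Definition borel_space (R : realType) d (E : measurableType d) : Prop :=
  exists (B : set R) (f : E -> R) (g : R -> E),
    [/\ measurable B,
        measurable_fun setT f /\ measurable_fun B g,
        forall e, B (f e),
        forall e, g (f e) = e &
        forall r, B r -> f (g r) = r].

Section conditioning.
Context d (T : measurableType d) (R : realType) (P : probability T R).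
Local Open Scope ereal_scope.

(* g is a version of the conditional probability P(A | F), for F a
   sub-sigma-algebra given as a set of sets. *)
Definition cond_prob (F : set (set T)) (A : set T) (g : T -> \bar R) : Prop :=
  [/\ forall B : set (\bar R), measurable B -> F (g @^-1` B),
      P.-integrable setT g &
      forall B, F B -> \int[P]_(w in B) g w = P (A `&` B)].

Definition regular_cond_dist d1 d2 (S : measurableType d1)
    (S' : measurableType d2) (Y : T -> S) (X : T -> S')
    (k : R.-pker S' ~> S) : Prop :=
  forall A, measurable A ->
    cond_prob (g_sigma_algebra_preimage X) (Y @^-1` A) (fun w => k (X w) A).

Definition cond_independent (I : choiceType) d1 d2 (S : measurableType d1)
    (E : measurableType d2) (X : I -> T -> S) (Z : T -> E) : Prop :=
  forall (J : {fset I}) (B : I -> set S) (g : I -> T -> \bar R)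
    (h : T -> \bar R),
    (forall j, measurable (B j)) ->
    (forall j, j \in J ->
      cond_prob (g_sigma_algebra_preimage Z) (X j @^-1` B j) (g j)) ->
    cond_prob (g_sigma_algebra_preimage Z)
      (\bigcap_(j in [set` J]) X j @^-1` B j) h ->
    {ae P, forall w, h w = \prod_(j <- J) g j w}.

End conditioning.

Section all_but_one.
Context d (T : measurableType d) (R : realType) (P : probability T R).
Local Open Scope ereal_scope.

(* X_{-i}: bump i is the increasing enumeration of N \ {i}, which identifies
   R^(N \ {i}) with R^N. *)
Definition allbut (X : {RV P >-> R}^nat) (i : nat) : T -> seqspace R :=
  fun w j => X (bump i j) w.

Lemma measurable_allbut (X : {RV P >-> R}^nat) (i : nat) :
  measurable_fun setT (allbut X i).
Proof. by apply: measurable_fun_seqspace => j; exact: measurable_funPT. Qed.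

HB.instance Definition _ (X : {RV P >-> R}^nat) (i : nat) :=
  isMeasurableFun.Build _ _ _ _ (allbut X i) (measurable_allbut X i).

Definition adjusted_mean (X : {RV P >-> R}^nat)
    (k : nat -> R.-pker (R * seqspace R) ~> R) (i : nat) (x : R) : \bar R :=
  \int[distribution P (allbut X i)]_xs \int[k i (x, xs)]_y y%:E.

End all_but_one.

(* Main.v *)
Require Import Defs.
From HB Require Import structures.
From mathcomp Require Import all_boot all_order all_algebra.
From mathcomp Require Import finmap.
From mathcomp Require Import all_classical all_reals all_analysis.
From mathcomp Require Import measurable_function measurable_realfun.

Set Implicit Arguments.
Unset Strict Implicit.
Unset Printing Implicit Defensive.

Import Order.TTheory GRing.Theory Num.Theory.
Import numFieldNormedType.Exports.

Local Open Scope classical_set_scope.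
Local Open Scope ring_scope.
Local Open Scope ereal_scope.

(** Write V for X_{-i} and W for the pair (X_i, Z).

    The crux is that the given kernel Pz, a conditional law of V given Z alone,
    is also a conditional law of V given W ([regular_cond_dist_allbut]): once Z
    is known, X_i carries no information on the other coordinates.  On a
    rectangle B x G of values of W and a cylinder F of values of V this reads
      E[1_G(Z) 1_B(X_i) Pz_Z(F)] = P(X_i \in B, V \in F, Z \in G).
    Both sides equal E[1_G(Z) P(X_i \in B | Z) Pz_Z(F)]: the left one by the
    defining property of P(X_i \in B | Z), the right one by conditional
    independence applied to the coordinates in F with and without X_i, the
    case without X_i identifying the product of the conditional probabilities
    with Pz_Z(F).  Rectangles and cylinders being pi-systems that generate the
    product sigma-algebras, [regular_cond_dist_pi_system] concludes.

    Conditional laws are used through [disintegration]: if k is a conditional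
    law of V given W, then
      E[phi(W, V); W \in D] = E[\int phi(W, v) k_W(dv); W \in D]
    for every measurable phi >= 0.

    - With phi((x, z), v) = P^i_{x,v}(A), the right-hand side is
      E[Q_W(A); W \in D] and the left-hand side is
      E[P^i_{X_i,V}(A); W \in D] = P(Y \in A, W \in D), because the event
      W \in D belongs to sigma(X_i, V) as soon as Z is sigma(V)-measurable.
      So Q is a conditional law of Y given W ([regular_cond_dist_kforget]).
    - With W replaced by Z and phi depending on v only, it says that the law of
      V is the mixture of the Pz_z over the law of Z, whence the formula for
      the adjusted mean on the positive and the negative parts of y; the
      integrability assumption allows to subtract
      ([integral_distribution_mixture]). *)

(** * Generators of product sigma-algebras *)

(** Since the whole spaces belong to the generating families, the rectangles
    include the strips A x S2 and S1 x B, and the preimages of a generating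
    family under a projection generate the preimage sigma-algebra. *)
Lemma g_sigma_prod d1 d2 (S1 : measurableType d1) (S2 : measurableType d2)
    (G1 : set (set S1)) (G2 : set (set S2)) :
  @measurable _ S1 = <<s G1 >> -> @measurable _ S2 = <<s G2 >> ->
  G1 setT -> G2 setT ->
  @measurable _ (S1 * S2)%type = <<s [set A `*` B | A in G1 & B in G2] >>.
Proof.
move=> mG1 mG2 G1T G2T; apply/seteqP; split; last first.
  apply: smallest_sub; first exact: sigma_algebra_measurable.
  move=> _ [A G1A [B G2B <-]].
  by apply: measurableX; [rewrite mG1|rewrite mG2]; exact: sub_sigma_algebra.
apply: smallest_sub; first exact: smallest_sigma_algebra.
rewrite subUset; split.
- suff : preimage_set_system setT (@fst S1 S2) <<s G1 >> `<=`
         <<s [set A `*` B | A in G1 & B in G2] >> by rewrite -mG1.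
  rewrite -(g_sigma_preimageE setT (@fst S1 S2) G1).
  apply: smallest_sub; first exact: smallest_sigma_algebra.
  move=> _ [A G1A <-]; apply: sub_sigma_algebra.
  by exists A => //; exists setT => //; rewrite setTI setXT.
- suff : preimage_set_system setT (@snd S1 S2) <<s G2 >> `<=`
         <<s [set A `*` B | A in G1 & B in G2] >> by rewrite -mG2.
  rewrite -(g_sigma_preimageE setT (@snd S1 S2) G2).
  apply: smallest_sub; first exact: smallest_sigma_algebra.
  move=> _ [A G2A <-]; apply: sub_sigma_algebra.
  by exists setT => //; exists A => //; rewrite setTI setTX.
Qed.

Lemma setI_closed_rect (S1 S2 : Type) (G1 : set (set S1)) (G2 : set (set S2)) :
  setI_closed G1 -> setI_closed G2 ->
  setI_closed [set A `*` B | A in G1 & B in G2].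
Proof.
move=> I1 I2 _ _ [A GA [B GB <-]] [A' GA' [B' GB' <-]].
exists (A `&` A'); first exact: I1.
by exists (B `&` B'); [exact: I2|rewrite setXI].
Qed.

Section cylinders.
Context d (S : measurableType d).

Definition cylinder (J : {fset nat}) (C : nat -> set S) : set (seqspace S) :=
  [set xs | forall j, j \in J -> C j (xs j)].

Definition cylinders : set (set (seqspace S)) :=
  [set F | exists J C, (forall j, measurable (C j)) /\ F = cylinder J C].

Lemma measurable_cylinder (J : {fset nat}) (C : nat -> set S) :
  (forall j, measurable (C j)) -> measurable (cylinder J C).
Proof.
move=> mC; rewrite (_ : cylinder J C =
    \bigcap_(j in [set` J]) ((fun xs : seqspace S => xs j) @^-1` C j)); last first.
  by apply/seteqP; split => xs /=; apply.
apply: bigcap_measurableType => j _.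
by rewrite -[X in measurable X]setTI; exact: measurable_seqspace_coord.
Qed.

Lemma cylindersT : cylinders setT.
Proof.
exists fset0, (fun=> setT); split=> //.
by apply/seteqP; split.
Qed.

(** Two cylinders over different finite index sets are intersected over the
    union of these, each being extended by trivial constraints. *)
Lemma setI_closed_cylinders : setI_closed cylinders.
Proof.
move=> _ _ [J [C [mC ->]]] [J' [C' [mC' ->]]].
pose ext (K : {fset nat}) (B : nat -> set S) j :=
  if j \in K then B j else setT.
exists (J `|` J')%fset, (fun j => ext J C j `&` ext J' C' j); split.
  by move=> j; apply: measurableI; rewrite /ext; case: ifP.
apply/seteqP; split => xs /=.
  move=> [JC JC'] j _; rewrite /ext.
  by split; case: ifP => [|//]; [exact: JC|exact: JC'].
move=> H; split=> j jJ; have := H j; rewrite inE jJ ?orbT => /(_ isT);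
  by rewrite /ext jJ => -[].
Qed.

Lemma g_sigma_cylinders : @measurable _ (seqspace S) = <<s cylinders >>.
Proof.
apply/seteqP; split; last first.
  apply: smallest_sub; first exact: sigma_algebra_measurable.
  by move=> _ [J [C [mC ->]]]; exact: measurable_cylinder.
apply: smallest_sub; first exact: smallest_sigma_algebra.
move=> _ [j _ [B mB <-]]; apply: sub_sigma_algebra.
exists [fset j]%fset, (fun=> B); split => //.
rewrite setTI; apply/seteqP; split => xs /=.
  by move=> Bxs k; rewrite inE => /eqP ->.
by apply; rewrite inE.
Qed.

End cylinders.

(** * Constructions of kernels *)

Lemma measurable_preimage d1 d2 (S1 : measurableType d1)
    (S2 : measurableType d2) (f : S1 -> S2) (B : set S2) :
  measurable_fun setT f -> measurable B -> measurable (f @^-1` B).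
Proof. by move=> mf mB; rewrite -[X in measurable X]setTI; exact: mf. Qed.

(** The pushforward of a measure is a measure only in the presence of a proof of
    measurability, which cannot be inferred for an unbundled function. *)
Definition image_measure d1 d2 (S1 : measurableType d1)
    (S2 : measurableType d2) (R : realType) (mu : {measure set S1 -> \bar R})
    (f : S1 -> S2) (mf : measurable_fun setT f) :
    {measure set S2 -> \bar R} :=
  measure_function_pushforward__canonical__measure_function_Measure mu mf.

Section kernel_constructions.
Context d1 d2 d3 (S1 : measurableType d1) (S2 : measurableType d2)
  (S3 : measurableType d3) (R : realType).

Section kernel_precomposition.
Variables (k : R.-pker S2 ~> S3) (f : S1 -> S2).

Definition kprecomp (mf : measurable_fun setT f) (x : S1) :
  {measure set S3 -> \bar R} := k (f x).

Hypothesis mf : measurable_fun setT f.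

Let measurable_kprecomp U : measurable U ->
  measurable_fun setT (kprecomp mf ^~ U).
Proof.
by move=> mU; exact: (measurableT_comp (measurable_kernel k U mU) mf).
Qed.

HB.instance Definition _ := isKernel.Build _ _ _ _ _ (kprecomp mf)
  measurable_kprecomp.

Let kprecomp_prob x : kprecomp mf x setT = 1.
Proof. exact: prob_kernel. Qed.

HB.instance Definition _ := Kernel_isProbability.Build _ _ _ _ _
  (kprecomp mf) kprecomp_prob.

End kernel_precomposition.

Section kernel_mixture.
Variables (l : R.-pker S1 ~> S2) (k : R.-pker (S1 * S2) ~> S3).

(** A separate name for the composition of kernels, so that it bears the
    structure of a probability kernel next to that of an s-finite kernel. *)
Definition kmix : S1 -> {measure set S3 -> \bar R} := mkcomp l k.

Let measurable_kmix U : measurable U -> measurable_fun setT (kmix ^~ U).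
Proof. exact: measurable_fun_mkcomp_sfinite. Qed.

HB.instance Definition _ := isKernel.Build _ _ _ _ _ kmix measurable_kmix.

Let kmix_prob x : kmix x setT = 1.
Proof.
transitivity (\int[l x]_y (cst 1 y)).
  by apply: eq_integral => y _; exact: prob_kernel.
by rewrite integral_cst// mul1e; exact: prob_kernel.
Qed.

HB.instance Definition _ := Kernel_isProbability.Build _ _ _ _ _
  kmix kmix_prob.

End kernel_mixture.

Section graph_kernel.
Variable k : R.-pker S1 ~> S2.

(** The law of (x, V) for V distributed as k x: mixing these laws over x turns a
    kernel into a measure on pairs, whose integrals are then given by the
    composition of kernels. *)
Definition kgraph (x : S1) : {measure set (S1 * S2) -> \bar R} :=
  image_measure (k x) (measurable_pair1 x).

Lemma kgraphE x U : kgraph x U = k x (xsection U x).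
Proof. by rewrite xsectionE. Qed.

Let measurable_kgraph U : measurable U -> measurable_fun setT (kgraph ^~ U).
Proof.
move=> mU; under eq_fun do rewrite kgraphE.
by apply: measurable_fun_xsection_finite_kernel; rewrite inE.
Qed.

HB.instance Definition _ := isKernel.Build _ _ _ _ _ kgraph measurable_kgraph.

Let kgraph_prob x : kgraph x setT = 1.
Proof. by rewrite /kgraph/= /pushforward preimage_setT prob_kernel. Qed.

HB.instance Definition _ := Kernel_isProbability.Build _ _ _ _ _
  kgraph kgraph_prob.

End graph_kernel.
End kernel_constructions.

(** * Disintegration along a conditional law *)

Section disintegration.
Context d d1 d2 (T : measurableType d) (S1 : measurableType d1)
  (S2 : measurableType d2) (R : realType) (P : probability T R).
Variables (W : T -> S1) (V : T -> S2) (k : R.-pker S1 ~> S2).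
Hypotheses (mW : measurable_fun setT W) (mV : measurable_fun setT V).

Let mWV : measurable_fun setT (fun w => (W w, V w)).
Proof. exact: measurable_fun_pair. Qed.

Let pair_law : {measure set (S1 * S2) -> \bar R} :=
  image_measure P mWV.

Let mWsnd : measurable_fun setT (W \o @snd unit T).
Proof. exact: measurableT_comp. Qed.

(* The law on S1 * S2 obtained by drawing the first component as W and the
   second one from the kernel k; the space unit is the source of a constant
   kernel. *)
Let glued_law : {measure set (S1 * S2) -> \bar R} :=
  kmix (kprobability (measurable_cst (P : pprobability T R)))
       (kprecomp (kgraph k) mWsnd) tt.

Let glued_lawE A : measurable A ->
  glued_law A = \int[P]_w k (W w) (xsection A (W w)).
Proof.
by move=> mA; apply: eq_integral => w _; rewrite /= -kgraphE.
Qed.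

Let integral_glued_law (phi : S1 * S2 -> \bar R) :
  measurable_fun setT phi -> (forall z, 0 <= phi z) ->
  \int[glued_law]_z phi z = \int[P]_w \int[k (W w)]_v phi (W w, v).
Proof.
move=> mphi phi0; rewrite [LHS]integral_kcomp//=.
apply: eq_integral => w _ /=.
by rewrite [LHS]ge0_integral_pushforward//; exact: measurable_pair1.
Qed.


Lemma kernel_rectE A B w :
  k (W w) (xsection (A `*` B) (W w)) = ((fun w => k (W w) B) \_ (W @^-1` A)) w.
Proof.
rewrite patchE; case: ifPn => Ww.
  by rewrite in_xsectionX//; move: Ww; rewrite !inE.
by rewrite notin_xsectionX ?measure0//; move: Ww; rewrite !inE.
Qed.

(** Both sides are finite measures in C that agree on a generating pi-system
    of rectangles. *)
Lemma joint_law_pi_system (G1 : set (set S1)) (G2 : set (set S2)) :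
  @measurable _ S1 = <<s G1 >> -> @measurable _ S2 = <<s G2 >> ->
  setI_closed G1 -> setI_closed G2 -> G1 setT -> G2 setT ->
  (forall A B, G1 A -> G2 B ->
    \int[P]_(w in W @^-1` A) k (W w) B = P (V @^-1` B `&` W @^-1` A)) ->
  forall C, measurable C ->
    P ((fun w => (W w, V w)) @^-1` C) = \int[P]_w k (W w) (xsection C (W w)).
Proof.
move=> mG1 mG2 IG1 IG2 G1T G2T rectE C mC.
rewrite -glued_lawE// -[LHS]/(pair_law C); apply/esym.
apply: (measure_unique [set A `*` B | A in G1 & B in G2] (fun=> setT)) => //.
- exact: g_sigma_prod.
- exact: setI_closed_rect.
- by move=> _; exists setT => //; exists setT => //; rewrite setXTT.
- by rewrite bigcup_const//; exists 0%N.
- move=> _ [A GA [B GB <-]].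
  have mA : measurable A by rewrite mG1; exact: sub_sigma_algebra.
  have mB : measurable B by rewrite mG2; exact: sub_sigma_algebra.
  rewrite glued_lawE; last exact: measurableX.
  have -> : pair_law (A `*` B) = P (V @^-1` B `&` W @^-1` A).
    by congr (P _); apply/seteqP; split => w /= [].
  rewrite -rectE// [RHS]integral_mkcond; apply: eq_integral => w _.
  exact: kernel_rectE.
- by move=> _; rewrite [ltLHS]prob_kernel ltry.
Qed.

Lemma integrable_kernel A : measurable A ->
  P.-integrable setT (fun w => k (W w) A).
Proof.
move=> mA; apply: (@le_integrable _ _ _ _ _ measurableT _ (cst 1)).
- exact: measurableT_comp (measurable_kernel k A mA) mW.
- move=> w _; rewrite gee0_abs// abse1.
  by rewrite -(prob_kernel (s:=k) (W w)) le_measure ?inE.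
- exact: finite_measure_integrable_cst.
Qed.

(** The defining identity of a conditional law only has to be tested on
    pi-systems in both variables. *)
Lemma regular_cond_dist_pi_system (G1 : set (set S1)) (G2 : set (set S2)) :
  @measurable _ S1 = <<s G1 >> -> @measurable _ S2 = <<s G2 >> ->
  setI_closed G1 -> setI_closed G2 -> G1 setT -> G2 setT ->
  (forall A B, G1 A -> G2 B ->
    \int[P]_(w in W @^-1` A) k (W w) B = P (V @^-1` B `&` W @^-1` A)) ->
  regular_cond_dist P V W k.
Proof.
move=> mG1 mG2 IG1 IG2 G1T G2T rectE B mB; split.
- move=> C mC; exists ((k ^~ B) @^-1` C); last by rewrite setTI.
  exact: measurable_preimage (measurable_kernel k B mB) mC.
- exact: integrable_kernel.
- move=> _ [A mA <-]; rewrite setTI.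
  rewrite integral_mkcond; under eq_integral do rewrite -kernel_rectE.
  rewrite -(joint_law_pi_system mG1 mG2)//; last exact: measurableX.
  by congr (P _); apply/seteqP; split => w /= [].
Qed.

(** The law of (W, V) is the law glued from that of W and the kernel k, hence
    the two sides are one and the same integral.  The restriction to W \in D is
    absorbed in the integrand psi. *)
Lemma disintegration (D : set S1) (phi : S1 * S2 -> \bar R) :
  regular_cond_dist P V W k -> measurable D ->
  measurable_fun setT phi -> (forall z, 0 <= phi z) ->
  \int[P]_(w in W @^-1` D) phi (W w, V w) =
  \int[P]_(w in W @^-1` D) \int[k (W w)]_v phi (W w, v).
Proof.
move=> kP mD mphi phi0.
pose psi := phi \_ (D `*` setT).
have psiE x v : psi (x, v) = if x \in D then phi (x, v) else 0.
  rewrite /psi patchE; congr (if _ then _ else _).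
  by apply/idP/idP; rewrite !inE => //= -[].
have mpsi : measurable_fun setT psi.
  apply/measurable_restrict => //; first exact: measurableX.
  by apply: measurable_funS mphi.
have psi0 z : 0 <= psi z by case: z => x v; rewrite psiE; case: ifP.
have jointE C : measurable C -> P ((fun w => (W w, V w)) @^-1` C) =
    \int[P]_w k (W w) (xsection C (W w)).
  apply: (joint_law_pi_system (G1 := measurable) (G2 := measurable)).
  - by rewrite sigma_algebra_id//; exact: sigma_algebra_measurable.
  - by rewrite sigma_algebra_id//; exact: sigma_algebra_measurable.
  - by move=> A B; exact: measurableI.
  - by move=> A B; exact: measurableI.
  - exact: measurableT.
  - exact: measurableT.
  - by move=> A B mA mB; have [_ _] := kP B mB; apply; exists A; rewrite ?setTI.
have inW w : (w \in W @^-1` D) = (W w \in D) by apply/idP/idP; rewrite !inE.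
transitivity (\int[P]_w psi (W w, V w)).
  by rewrite integral_mkcond; apply: eq_integral => w _; rewrite psiE patchE inW.
transitivity (\int[P]_w \int[k (W w)]_v psi (W w, v)); last first.
  rewrite [RHS]integral_mkcond; apply: eq_integral => w _; rewrite patchE inW.
  under eq_integral do rewrite psiE.
  by case: ifP => // _; rewrite integral0.
rewrite -integral_glued_law//.
transitivity (\int[pair_law]_z psi z).
  by rewrite [RHS]ge0_integral_pushforward.
by apply: eq_measure_integral => C mC _; rewrite glued_lawE// -jointE.
Qed.

End disintegration.

(** * Conditional probabilities as functions of the conditioning variable *)

Section conditional_probability_density.
Context d (T : measurableType d) (R : realType).

Lemma ge0_integral_mrestr (mu : {measure set T -> \bar R}) (A D : set T)
    (mA : measurable A) (f : T -> \bar R) :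
  measurable D -> measurable_fun setT f -> (forall x, 0 <= f x) ->
  \int[mrestr mu mA]_(x in D) f x = \int[mu]_(x in D `&` A) f x.
Proof.
move=> mD mf f0; rewrite -[in LHS](setUIDK D A) ge0_integral_setU//=.
- rewrite [X in _ + X]null_set_integral ?adde0.
  + apply: eq_measure_integral => B mB BDA.
    by rewrite /= /mrestr setIidl// => x /BDA[].
  + exact: measurableD.
  + exact: measurable_funS mf.
  + by rewrite /= /mrestr setDE (_ : _ `&` A = set0) ?measure0// -setIA setICl setI0.
- exact: measurableI.
- exact: measurableD.
- exact: measurable_funS mf.
- by rewrite disj_set2E; apply/eqP/seteqP; split => // x [[_ ?] []].
Qed.

Context (P : probability T R) dE (E : measurableType dE) (Z : T -> E).
Hypothesis mZ : measurable_fun setT Z.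

(** The function f is the density of G |-> P(A, Z \in G) with respect to the
    law of Z.  Beyond the existence of a version of P(A | Z), the lemma gives
    the rule for pulling a function of Z out of the conditional expectation,
    which for a density is the change of variables formula. *)
Lemma cond_prob_density (A : set T) : measurable A ->
  exists f : E -> \bar R,
  [/\ cond_prob P (g_sigma_algebra_preimage Z) A (f \o Z),
      measurable_fun setT f, forall z, 0 <= f z &
      forall (G : set E) (phi : E -> \bar R), measurable G ->
        measurable_fun setT phi -> (forall z, 0 <= phi z) ->
        \int[P]_(w in Z @^-1` G `&` A) phi (Z w) =
        \int[P]_(w in Z @^-1` G) (phi (Z w) * f (Z w))].
Proof.
move=> mA.
pose Zm : {mfun T >-> E} := HB.pack Z (isMeasurableFun.Build _ _ _ _ Z mZ).
pose mu : probability E R := distribution P Zm.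
pose nu0 := image_measure (mrestr P mA) mZ.
have fin_nu : fin_num_fun nu0.
  move=> G mG; rewrite ge0_fin_numE//.
  rewrite (@le_lt_trans _ _ 1) ?ltry//.
  apply: probability_le1; apply: measurableI => //.
  exact: measurable_preimage mG.
pose nu : {finite_measure set E -> \bar R} :=
  HB.pack (nu0 : set E -> \bar R) (Measure.on nu0)
    (Measure_isFinite.Build _ _ _ _ fin_nu).
have numu : nu `<< mu.
  apply/null_content_dominatesP => G mG muG0.
  have mZG : measurable (Z @^-1` G) by exact: measurable_preimage mG.
  apply/eqP; rewrite eq_le measure_ge0 andbT.
  by rewrite -[leRHS]muG0 /= /mrestr le_measure ?inE//; exact: measurableI.
pose f := Radon_Nikodym_SigmaFinite.f nu mu.
have f0 z : 0 <= f z by exact: Radon_Nikodym_SigmaFinite.f_ge0.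
have fint : mu.-integrable setT f.
  exact: Radon_Nikodym_SigmaFinite.f_integrable.
have mf : measurable_fun setT f := measurable_int mu fint.
exists f; split => //.
- split.
  + by move=> B mB; exists (f @^-1` B); rewrite ?setTI//; exact: measurable_preimage.
  + apply/integrableP; split; first exact: measurableT_comp.
    have /integrableP[_ +] := fint; rewrite ge0_integral_pushforward//.
    exact: measurableT_comp.
  + move=> _ [G mG <-]; rewrite setTI setIC.
    transitivity (\int[mu]_(z in G) f z).
      rewrite [RHS]ge0_integral_pushforward//.
      exact: measurable_funS mf.
    by rewrite -Radon_Nikodym_SigmaFinite.f_integral.
- move=> G phi mG mphi phi0.
  have mZG : measurable (Z @^-1` G) by exact: measurable_preimage mG.
  rewrite -(ge0_integral_mrestr P mA)//; last exact: measurableT_comp.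
  transitivity (\int[nu]_(z in G) phi z).
    by rewrite [RHS]ge0_integral_pushforward//; exact: measurable_funS mphi.
  rewrite -(Radon_Nikodym_SigmaFinite.change_of_variables numu)//; last first.
    exact: measurable_funS mphi.
  rewrite [LHS]ge0_integral_pushforward//.
    apply: emeasurable_funM; first exact: measurable_funS mphi.
    exact: measurable_funS mf.
  by move=> z _; rewrite mule_ge0.
Qed.

End conditional_probability_density.
(** * Conditional independence *)

Section conditional_independence.
Context d dE (T : measurableType d) (R : realType) (P : probability T R)
  (E : measurableType dE).
Variables (X : {RV P >-> R}^nat) (Z : {RV P >-> E}).

Lemma allbut_cylinder (i : nat) (J : {fset nat}) (C : nat -> set R) :
  allbut X i @^-1` cylinder J C =
  \bigcap_(m in [set` [fset bump i j | j in J]%fset])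
    X m @^-1` C (unbump i m).
Proof.
apply/seteqP; split => w /=.
  by move=> H _ /imfsetP[j /= jJ ->]; rewrite /= bumpK; exact: H.
move=> H j jJ; have := H (bump i j); rewrite /= bumpK; apply.
by apply/imfsetP; exists j.
Qed.

(** Given Z, the variable X_i is independent of the other coordinates, so that
    conditioning on X_i in addition to Z leaves their conditional law
    unchanged. *)
Lemma regular_cond_dist_allbut (i : nat) (Pz : R.-pker E ~> seqspace R) :
  cond_independent P X Z ->
  regular_cond_dist P (allbut X i) Z Pz ->
  regular_cond_dist P (allbut X i) (fun w => (X i w, Z w))
    (kprecomp Pz (measurable_snd : measurable_fun setT (@snd R E))).
Proof.
move=> Xindep HPz.
have mX m : measurable_fun setT (X m) by exact: measurable_funPT.
have mZ : measurable_fun setT Z by exact: measurable_funPT.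
apply: (regular_cond_dist_pi_system (measurable_fun_pair (mX i) mZ)
  (measurable_allbut X i) (measurable_prod_measurableType _ _)
  (g_sigma_cylinders _)).
- by apply: setI_closed_rect => A B; exact: measurableI.
- exact: setI_closed_cylinders.
- by exists setT => //; exists setT => //; rewrite setXTT.
- exact: cylindersT.
move=> _ _ [B mB [G mG <-]] [J [C [mC ->]]].
set F := cylinder J C.
have mF : measurable F by exact: measurable_cylinder.
(* One constraint per coordinate of X: B on X_i, those of the cylinder elsewhere. *)
pose A m := if m == i then B else C (unbump i m).
have mA m : measurable (A m) by rewrite /A; case: ifP.
have /choice[f f_] m := cond_prob_density P mZ (measurable_preimage (mX m) (mA m)).
pose J' := [fset bump i j | j in J]%fset.
have iJ' : i \notin J'.
  by apply/imfsetP => -[j _] /eqP; rewrite (negPf (neq_bump _ _)).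
have preF : allbut X i @^-1` F = \bigcap_(m in [set` J']) X m @^-1` A m.
  rewrite allbut_cylinder; apply: eq_bigcapr => m /= mJ'.
  by rewrite /A; case: eqP => // mi; rewrite -mi mJ' in iJ'.
have preiF : X i @^-1` B `&` allbut X i @^-1` F =
    \bigcap_(m in [set` i |` J']%fset) X m @^-1` A m.
  rewrite preF; apply/seteqP; split => w /=.
    move=> [Bw H] m /=; rewrite in_fset1U => /predU1P[->|/H//].
    by rewrite /A eqxx.
  move=> H; split.
    by have := H i; rewrite /A/= eqxx; apply; rewrite in_fset1U eqxx.
  by move=> m mJ'; apply: H; rewrite /= in_fset1U; apply/orP; right.
have mpreF : measurable (allbut X i @^-1` F).
  exact: measurable_preimage (measurable_allbut X i) mF.
have [h [hP mh h0 _]] := cond_prob_density P mZ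
  (measurableI _ _ (measurable_preimage (mX i) mB) mpreF).
(* Conditional independence without X_i, then with it: comparing the two
   products gives h = f_i * Pz(F), where h is P(X_i \in B, X_{-i} \in F | Z). *)
have PzE : {ae P, forall w, Pz (Z w) F = \prod_(m <- J') f m (Z w)}.
  apply: (Xindep J' A (fun m => f m \o Z)) => // [m _|].
    by have [] := f_ m.
  by rewrite -preF; exact: HPz.
have hE : {ae P, forall w, h (Z w) = \prod_(m <- (i |` J')%fset) f m (Z w)}.
  apply: (Xindep _ A (fun m => f m \o Z)) => // [m _|].
    by have [] := f_ m.
  by rewrite -preiF.
have mPzF : measurable_fun setT (Pz ^~ F) by exact: measurable_kernel.
have [_ mfi fi0 fipull] := f_ i.
have mZG : measurable (Z @^-1` G) by exact: measurable_preimage mG.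
have Ai : A i = B by rewrite /A eqxx.
have preBG : (fun w => (X i w, Z w)) @^-1` (B `*` G) =
    Z @^-1` G `&` X i @^-1` B.
  by apply/seteqP; split => w /= [].
rewrite preBG.
transitivity (\int[P]_(w in Z @^-1` G) (Pz (Z w) F * f i (Z w))).
  by rewrite -(fipull G (Pz ^~ F))// Ai.
transitivity (\int[P]_(w in Z @^-1` G) h (Z w)).
  apply: ge0_ae_eq_integral => //.
  - apply: measurable_funTS; apply: emeasurable_funM.
      exact: (measurableT_comp mPzF mZ).
    exact: (measurableT_comp mfi mZ).
  - by apply: measurable_funTS; exact: (measurableT_comp mh mZ).
  - by move=> w _; exact: mule_ge0.
  - near=> w => _; rewrite (near hE w)// (near PzE w)//.
    by rewrite big_fsetU1//= muleC.
have [_ _ ->] := hP; last by exists G; rewrite ?setTI.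
by congr (P _); rewrite setIC setIA [in RHS]setIC -setIA.
Unshelve. all: by end_near.
Qed.

End conditional_independence.

(** * Mixing out the other coordinates *)

Section mixture.
Context d d1 d2 d3 dE (T : measurableType d) (S1 : measurableType d1)
  (S2 : measurableType d2) (S3 : measurableType d3) (E : measurableType dE)
  (R : realType) (P : probability T R).

Let drop_mid (t : (S1 * E) * S2) : S1 * S2 := (t.1.1, t.2).

Let measurable_drop_mid : measurable_fun setT drop_mid.
Proof.
apply: measurable_fun_pair => //.
exact: (measurableT_comp measurable_fst measurable_fst).
Qed.

(** Starting from (x, z), draw v from l z, then draw from k (x, v): with
    l = P^{-i}_z and k = P^i this is the kernel Q^i. *)
Definition kforget (l : R.-pker E ~> S2) (k : R.-pker (S1 * S2) ~> S3) :
    S1 * E -> {measure set S3 -> \bar R} :=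
  kmix (kprecomp l (measurable_snd : measurable_fun setT (@snd S1 E)))
       (kprecomp k measurable_drop_mid).

HB.instance Definition _ l k := ProbabilityKernel.on (kforget l k).

Lemma integral_kforget (l : R.-pker E ~> S2) (k : R.-pker (S1 * S2) ~> S3)
    x z (f : S3 -> \bar R) :
  measurable_fun setT f -> (forall y, 0 <= f y) ->
  \int[kforget l k (x, z)]_y f y = \int[l z]_xs \int[k (x, xs)]_y f y.
Proof. by move=> mf f0; rewrite [LHS]integral_kcomp. Qed.

Variables (Y : T -> S3) (X : T -> S1) (V : T -> S2) (Z : T -> E).
Hypotheses (mX : measurable_fun setT X) (mV : measurable_fun setT V)
  (mZ : measurable_fun setT Z).

Lemma g_sigma_algebra_preimage_pair_sub :
  g_sigma_algebra_preimage Z `<=` g_sigma_algebra_preimage V ->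
  g_sigma_algebra_preimage (fun w => (X w, Z w)) `<=`
  g_sigma_algebra_preimage (fun w => (X w, V w)).
Proof.
move=> ZV _ [D mD <-].
pose XV : T -> S1 * S2 := fun w => (X w, V w).
pose T' := g_sigma_algebra_preimageType XV.
have mXV : measurable_fun setT (XV : T' -> S1 * S2).
  by move=> _ B mB; exists B.
have mXZ : measurable_fun setT ((fun w => (X w, Z w)) : T' -> S1 * E).
  apply: measurable_fun_pair.
    exact: (measurableT_comp measurable_fst mXV).
  move=> _ G mG.
  have [B mB <-] : g_sigma_algebra_preimage V (setT `&` Z @^-1` G).
    by apply: ZV; exists G.
  by exists (setT `*` B); [exact: measurableX|rewrite setTX].
exact: mXZ measurableT D mD.
Qed.

(** Averaging a conditional law of Y given (X, V) over the conditional law of V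
    given (X, Z) yields a conditional law of Y given the coarser (X, Z).  The
    two averages are over different variables, and are reconciled by the
    disintegration of (X, Z, V) along (X, Z). *)
Lemma regular_cond_dist_kforget (l : R.-pker E ~> S2)
    (k : R.-pker (S1 * S2) ~> S3) :
  g_sigma_algebra_preimage Z `<=` g_sigma_algebra_preimage V ->
  regular_cond_dist P Y (fun w => (X w, V w)) k ->
  regular_cond_dist P V (fun w => (X w, Z w))
    (kprecomp l (measurable_snd : measurable_fun setT (@snd S1 E))) ->
  regular_cond_dist P Y (fun w => (X w, Z w)) (kforget l k).
Proof.
move=> ZV HY HV A mA; have mXZ := measurable_fun_pair mX mZ; split.
- move=> C mC; exists ((kforget l k ^~ A) @^-1` C); last by rewrite setTI.
  exact: measurable_preimage (measurable_kernel _ A mA) mC.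
- exact: integrable_kernel.
- move=> C XZC; have [D mD] := XZC; rewrite setTI => CE.
  have [_ _ <-] := HY A mA; last exact: g_sigma_algebra_preimage_pair_sub.
  rewrite -CE.
  rewrite (disintegration mXZ mV (phi := fun t => k (drop_mid t) A) HV)//.
  exact: (measurableT_comp (measurable_kernel k A mA) measurable_drop_mid).
Qed.

End mixture.

(** Integrating first over V given Z and then over Z amounts to integrating over
    V.  This is valid for nonnegative functions; since the integral of a
    signed function is the difference of the integrals of its positive and
    negative parts, and since these differences must commute with the outer
    integrals, finiteness of the absolute moment is required. *)
Lemma integral_distribution_mixture d dE d2 (T : measurableType d)
    (R : realType) (P : probability T R) (E : measurableType dE)
    (S : measurableType d2) (V : {RV P >-> S}) (Z : {RV P >-> E})
    (l : R.-pker E ~> S) (k : R.-pker S ~> R)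
    (Q : E -> {measure set R -> \bar R}) :
  regular_cond_dist P V Z l ->
  (forall z (f : R -> \bar R), measurable_fun setT f -> (forall y, 0 <= f y) ->
    \int[Q z]_y f y = \int[l z]_v \int[k v]_y f y) ->
  \int[distribution P V]_v \int[k v]_y `|y|%:E < +oo ->
  \int[distribution P V]_v \int[k v]_y y%:E =
  \int[distribution P Z]_z \int[Q z]_y y%:E.
Proof.
move=> HV QE fin.
have mV : measurable_fun setT V by exact: measurable_funPT.
have mZ : measurable_fun setT Z by exact: measurable_funPT.
pose m (f : R -> \bar R) v := \int[k v]_y f y.
have mm f : measurable_fun setT f -> (forall y, 0 <= f y) ->
    measurable_fun setT (m f).
  by move=> mf f0; apply: (measurable_fun_integral_kernel (measurable_kernel k)).
have m0 f : (forall y, 0 <= f y) -> forall v, 0 <= m f v.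
  by move=> f0 v; exact: integral_ge0.
have tower f : measurable_fun setT f -> (forall y, 0 <= f y) ->
    \int[distribution P V]_v m f v = \int[distribution P Z]_z \int[Q z]_y f y.
  move=> mf f0.
  have mmf := mm _ mf f0; have m0f := m0 _ f0.
  under [RHS]eq_integral do rewrite QE//.
  rewrite ge0_integral_distribution//.
  rewrite ge0_integral_distribution//; last 2 first.
  - exact: (measurable_fun_integral_kernel (measurable_kernel l)).
  - by move=> z; apply: integral_ge0 => v _; exact: m0f.
  apply: (disintegration mZ mV HV (D := setT)
    (phi := m f \o snd) measurableT (measurableT_comp mmf measurable_snd)).
  by move=> z; exact: m0f.
pose id_ (y : R) := y%:E.
have mid : measurable_fun setT id_ by apply/measurable_EFinP; exact: measurable_id.
have mp : measurable_fun setT id_^\+ by exact: measurable_funepos.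
have mn : measurable_fun setT id_^\- by exact: measurable_funeneg.
have mabs : measurable_fun setT (fun y : R => `|y|%:E).
  by apply/measurable_EFinP; exact: normr_measurable.
have absE (y : R) : `|y|%:E = id_^\+ y + id_^\- y.
  by have /(congr1 (@^~ y)) := fune_abse id_.
have fin_part (f : R -> \bar R) : measurable_fun setT f -> (forall y, 0 <= f y) ->
    (forall y : R, f y <= `|y|%:E) ->
    (distribution P V).-integrable setT (m f) /\
    (distribution P Z).-integrable setT (fun z => \int[Q z]_y f y).
  move=> mf f0 fle.
  have foo : \int[distribution P V]_v m f v < +oo.
    apply: le_lt_trans fin; apply: ge0_le_integral => //.
    - by move=> v _; exact: m0.
    - exact: mm.
    - by apply: mm => //; exact: mabs.
    - by move=> v _; apply: ge0_le_integral => //; exact: mabs.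
  split; apply/integrableP; split.
  - exact: mm.
  - by under eq_integral do rewrite gee0_abs ?m0//.
  - under eq_fun do rewrite QE//.
    apply: (measurable_fun_integral_kernel (measurable_kernel l)).
      exact: m0.
    exact: mm.
  - under eq_integral do rewrite gee0_abs ?integral_ge0//.
    by rewrite -tower.
have [ip jp] : (distribution P V).-integrable setT (m id_^\+) /\
    (distribution P Z).-integrable setT (fun z => \int[Q z]_y id_^\+ y).
  by apply: fin_part => // y; rewrite absE leeDl.
have [in_ jn] : (distribution P V).-integrable setT (m id_^\-) /\
    (distribution P Z).-integrable setT (fun z => \int[Q z]_y id_^\- y).
  by apply: fin_part => // y; rewrite absE leeDr.
transitivity (\int[distribution P V]_v (m id_^\+ \- m id_^\-) v).
  by apply: eq_integral => v _; rewrite integralE.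
rewrite integralB//.
rewrite !tower// -integralB//.
by apply: eq_integral => z _; rewrite [RHS]integralE.
Qed.

Theorem proposition1
  (d dE : measure_display) (T : measurableType d) (R : realType)
  (P : probability T R) (E : measurableType dE)
  (Y : {RV P >-> R}) (X : {RV P >-> R}^nat) (Z : {RV P >-> E})
  (HE : borel_space R E)
  (Pk : nat -> R.-pker (R * seqspace R) ~> R)
  (HPk : forall i, regular_cond_dist P Y
           (fun w => (X i w, allbut X i w)) (Pk i))
  (HPint : forall i x,
     \int[distribution P (allbut X i)]_xs \int[Pk i (x, xs)]_y `|y|%:E < +oo)
  (Hindep : cond_independent P X Z)
  (Hsigma : g_sigma_algebra_preimage Z `<=`
              \bigcap_i g_sigma_algebra_preimage (allbut X i))
  (i : nat)
  (Pz : R.-pker E ~> seqspace R)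
  (HPz : regular_cond_dist P (allbut X i) Z Pz) :
  exists Q : R.-pker (R * E) ~> R,
    [/\ forall x z A, measurable A ->
          Q (x, z) A = \int[Pz z]_xs Pk i (x, xs) A,
        regular_cond_dist P Y (fun w => (X i w, Z w)) Q &
        forall x, adjusted_mean X Pk i x =
          \int[distribution P Z]_z \int[Q (x, z)]_y y%:E].
Proof.
exists (kforget Pz (Pk i)); split.
- by [].
- apply: regular_cond_dist_kforget.
  + exact: measurable_funPT.
  + exact: measurable_allbut.
  + exact: measurable_funPT.
  + by move=> B /Hsigma; exact.
  + exact: HPk.
  + exact: regular_cond_dist_allbut.
- move=> x.
  apply: (integral_distribution_mixture (k := kprecomp (Pk i)
    (measurable_pair1 x)) (Q := fun z => kforget Pz (Pk i) (x, z)) HPz).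
  + by move=> z f mf f0; exact: integral_kforget.
  + exact: HPint.
Qed.
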